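(* Fix an integer $p\ge 2$ and let $x_0,x_1,x_2,\dots$ be the standard generators of the Brown–Thompson group $F_p$. In the group algebra $\mathbb{C}[F_p]$ set $$a_n:=\frac{x_n+x_n^{-1}}{\sqrt 2},\qquad s_n:=\frac{a_0+a_1+\dots+a_{n-1}}{\sqrt n}\quad(n\ge 1).$$ Then for every $d\in\mathbb N$, $$\lim_{n\to\infty}\gamma(s_n^d)=\begin{cases}(d-1)!! & d \text{ even},\\ 0 & d \text{ odd},\end{cases}$$ i.e. the moments of $s_n$ with respect to $\gamma$ converge to those of the standard normal distribution $N(0,1)$, so $s_n$ converges in distribution to a standard normal random variable.
   Context: $F_p$ is the group with presentation $\langle x_0,x_1,\dots \mid x_nx_k=x_kx_{n+p-1}\ \text{for all } k<n\rangle$, with identity $e$. The canonical trace $\gamma:\mathbb{C}[F_p]\to\mathbb{C}$ is the linear functional with $\gamma(g)=\delta_{g,e}$ for $g\in F_p$. For $d$ even, $(d-1)!!=(d-1)(d-3)\cdots 3\cdot 1$. *)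

(* Defs.v *)
From HB Require Import structures.
From mathcomp Require Import all_boot all_order all_algebra.
From mathcomp Require Import all_classical all_reals all_analysis.
Set Implicit Arguments. Unset Strict Implicit. Unset Printing Implicit Defensive.
Import Order.TTheory GRing.Theory Num.Theory.
Local Open Scope ring_scope.

(* Words in the generators x_i^{+-1}: (i, true) = x_i, (i, false) = x_i^{-1}. *)
Definition letter := (nat * bool)%type.
Definition word := seq letter.

(* The congruence on words defining the group F_p by its presentation
   < x_0, x_1, ... | x_n x_k = x_k x_{n+p-1}  (k < n) >:
   smallest equivalence relation, compatible with concatenation, containing
   free cancellation and the defining relations.  Words modulo fp_equiv p
   is exactly the group F_p. *)
Inductive fp_equiv (p : nat) : word -> word -> Prop :=
  | fp_refl w : fp_equiv p w w
  | fp_sym u v : fp_equiv p u v -> fp_equiv p v u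
  | fp_trans u v w : fp_equiv p u v -> fp_equiv p v w -> fp_equiv p u w
  | fp_ctx a b u v : fp_equiv p u v -> fp_equiv p (a ++ u ++ b) (a ++ v ++ b)
  | fp_cancel i e : fp_equiv p [:: (i, e); (i, ~~ e)] [::]
  | fp_rel n k : (k < n)%N ->
      fp_equiv p [:: (n, true); (k, true)] [:: (k, true); (n + p - 1, true)]%N.

Definition fp_trivial (p : nat) (w : word) : bool := `[< fp_equiv p w [::] >].

(* Elements of the group algebra, represented as formal linear combinations
   of words (the quotient map to K[F_p] is linear and multiplicative). *)
Definition galg (R : nzRingType) := seq (R * word)%type.

Section GAlg.
Variable R : nzRingType.
Definition ga_add (f g : galg R) : galg R := f ++ g.
Definition ga_scale (c : R) (f : galg R) : galg R := [seq (c * t.1, t.2) | t <- f].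
Definition ga_mul (f g : galg R) : galg R :=
  [seq (t.1 * u.1, t.2 ++ u.2) | t <- f, u <- g].
Definition ga_one : galg R := [:: (1, [::])].
Definition ga_pow (f : galg R) (d : nat) : galg R := iter d (ga_mul f) ga_one.
Definition ga_sum (n : nat) (F : nat -> galg R) : galg R :=
  foldr ga_add [::] [seq F i | i <- iota 0 n].
Definition ga_gen (i : nat) (e : bool) : galg R := [:: (1, [:: (i, e)])].
Definition gamma (p : nat) (f : galg R) : R :=
  \sum_(t <- f) (if fp_trivial p t.2 then t.1 else 0).
End GAlg.

Definition a_el (R : realType) (n : nat) : galg R :=
  ga_scale (Num.sqrt 2)^-1 (ga_add (ga_gen R n true) (ga_gen R n false)).

Definition s_el (R : realType) (n : nat) : galg R :=
  ga_scale (Num.sqrt (n%:R))^-1 (ga_sum n (a_el R)).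

Fixpoint dfact (m : nat) : nat :=
  match m with
  | 0 => 1
  | 1 => 1
  | (S (S k)) as m' => m' * dfact k
  end.

(* Main.v *)
(** Let [F_p] act on the right on the line by piecewise linear maps: [x_k] fixes
    the points below [k] and translates those above [k + 1] by [q = p - 1].  If a
    word [w] is trivial in [F_p], then at every point far from all its indices
    the letters of smaller index have total exponent [0]; hence no letter of [w]
    is isolated.  The words of length [d] all of whose letters have a close
    companion are covered by fewer than [d/2] small balls, so that there are
    [O(n^((d-1)/2))] of them, unless their letters are close exactly in pairs.

    For a paired word, pushing every letter to the right past the letters of
    smaller index only shifts indices by a bounded amount, and following the
    integer points near a pair shows that the word is trivial exactly when the
    shifted word uses each of its generators once with each sign.  There are
    ['C(n, d/2) * d!] such "ideal" words, which is asymptotic to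
    [(2n)^(d/2) (d-1)!!]. *)

Require Import Defs.
From HB Require Import structures.
From mathcomp Require Import all_boot all_order all_algebra.
From mathcomp Require Import all_classical all_reals all_analysis.
From mathcomp Require Import zify ring lra.
Set Implicit Arguments. Unset Strict Implicit. Unset Printing Implicit Defensive.
Import Order.TTheory GRing.Theory Num.Theory.
Import numFieldNormedType.Exports.

(** * Moments count trivial words *)

Local Open Scope nat_scope.

Fixpoint words (T : Type) (al : seq T) (d : nat) : seq (seq T) :=
  if d is d'.+1 then [seq l :: w | l <- al, w <- words al d'] else [:: [::]].

Lemma size_words (T : Type) (al : seq T) d : size (words al d) = size al ^ d.
Proof. by elim: d => //= d IH; rewrite size_allpairs IH expnS. Qed.

Lemma mem_words (T : eqType) (al : seq T) d w :
  (w \in words al d) = (size w == d) && all (mem al) w.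
Proof.
elim: d w => [|d IH] [|x w] //=.
  by apply/allpairsP => -[[y v] []].
rewrite eqSS andbCA -IH; apply/allpairsP/andP => [[[y v] /= [hy hv [-> ->]]]|[hx hw]] //.
by exists (x, w).
Qed.

Lemma words_uniq (T : eqType) (al : seq T) d : uniq al -> uniq (words al d).
Proof.
move=> al_uniq; elim: d => //= d IH; apply: allpairs_uniq => //.
by move=> [x v] [y w] _ _ /= [-> ->].
Qed.

Definition alph (n : nat) : seq letter :=
  [seq (i, e) | i <- iota 0 n, e <- [:: true; false]].

Lemma mem_alph n l : (l \in alph n) = (l.1 < n).
Proof.
apply/allpairsP/idP => [[[i e] [hi _ ->]]|hl]; first by rewrite mem_iota in hi.
by exists l; split; [rewrite mem_iota | case: l.2 | case: l {hl}].
Qed.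

Lemma alph_uniq n : uniq (alph n).
Proof. by apply: allpairs_uniq => //; [exact: iota_uniq | move=> [? ?] [? ?]]. Qed.

Lemma mem_words_alph n d w :
  (w \in words (alph n) d) = (size w == d) && all (fun l => l.1 < n) w.
Proof. by rewrite mem_words; congr andb; apply: eq_all => l; exact: mem_alph. Qed.

Local Open Scope ring_scope.

Lemma s_elE (R : realType) n :
  s_el R n = [seq ((Num.sqrt n%:R)^-1 * ((Num.sqrt 2)^-1 * 1), [:: l]) | l <- alph n].
Proof.
rewrite /s_el /ga_sum /alph; elim: (iota 0 n) => //= i s IH.
by congr [:: _, _ & _].
Qed.

Lemma ga_powE (R : nzRingType) (c : R) (al : seq letter) d :
  ga_pow [seq (c, [:: l]) | l <- al] d = [seq (c ^+ d, w) | w <- words al d].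
Proof.
elim: d => [|d IH]; first by rewrite /= expr0.
rewrite /ga_pow /= -/(ga_pow _ d) IH /ga_mul exprS.
elim: al {IH} (words al d) => //= l al IHal ws.
by rewrite map_cat IHal -!map_comp.
Qed.

(** All letters of [s_el] carry one common coefficient and formal products never merge words, so the
    limit theorem becomes a counting problem. *)
Lemma gamma_s_el (R : realType) p n d :
  gamma p (ga_pow (s_el R n) d) =
  ((Num.sqrt n%:R)^-1 * (Num.sqrt 2)^-1) ^+ d
    * (count (fp_trivial p) (words (alph n) d))%:R.
Proof.
rewrite s_elE mulr1 ga_powE /gamma big_map /=.
by rewrite -big_mkcond /= big_const_seq iter_addr_0 mulr_natr.
Qed.

(** * A piecewise linear action *)

(** The slope [q + 1] on the interval from [k] to [k + 1] joins the identity continuously to the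
    translation by [q]. *)
Definition pl_letter (q : nat) (l : letter) (t : rat) : rat :=
  let k := l.1%:R in
  if t <= k then t
  else if l.2 then (if t <= k + 1 then k + (q%:R + 1) * (t - k) else t + q%:R)
  else (if t <= k + 1 + q%:R then k + (t - k) / (q%:R + 1) else t - q%:R).

Definition pl_word (q : nat) (w : word) (t : rat) : rat :=
  foldl (fun s l => pl_letter q l s) t w.

Lemma pl_word_cat q u v t : pl_word q (u ++ v) t = pl_word q v (pl_word q u t).
Proof. exact: foldl_cat. Qed.

Lemma pl_letterK q i e t : pl_letter q (i, ~~ e) (pl_letter q (i, e) t) = t.
Proof.
have q0 : (0 : rat) <= q%:R by rewrite ler0n.
rewrite /pl_letter /=; move: (q%:R : rat) (i%:R : rat) q0 => Q k Q0.
case: e => /=.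
  case: (lerP t k) => h1; first by rewrite h1.
  case: (lerP t (k + 1)) => h2.
    rewrite ifF; last by apply/negbTE; rewrite -ltNge; nra.
    rewrite ifT; last by nra.
    by field; lra.
  rewrite ifF; last by apply/negbTE; lra.
  by rewrite ifF; [lra | apply/negbTE; lra].
case: (lerP t k) => h1; first by rewrite h1.
case: (lerP t (k + 1 + Q)) => h2.
  (* This substitution removes the division, leaving polynomial inequalities. *)
  have [s ts] : exists s, t = k + (Q + 1) * s.
    by exists ((t - k) / (Q + 1)); field; lra.
  have -> : (t - k) / (Q + 1) = s by rewrite ts; field; lra.
  rewrite ifF; last by apply/negbTE; rewrite -ltNge; nra.
  by rewrite ifT; [rewrite ts; ring | nra].
rewrite ifF; last by apply/negbTE; lra.
by rewrite ifF; [lra | apply/negbTE; lra].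
Qed.

(** Above [n], hence above [k + 1], the map of [x_k] is the translation by [q], which conjugates
    [x_n] into [x_{n+q}]. At points up to [n], neither [x_n] before [x_k] nor [x_{n+q}] after it
    moves anything. *)
Lemma pl_letter_rel q n k t : (k < n)%N ->
  pl_letter q (k, true) (pl_letter q (n, true) t) =
  pl_letter q ((n + q)%N, true) (pl_letter q (k, true) t).
Proof.
move=> kn.
have q0 : (0 : rat) <= q%:R by rewrite ler0n.
have {}kn : (k%:R : rat) + 1 <= n%:R by rewrite natr1 ler_nat.
rewrite /pl_letter /= natrD.
move: (q%:R : rat) (k%:R : rat) (n%:R : rat) q0 kn => Q K N Q0 KN.
have ifF' : forall b (x y : rat), ~~ b -> (if b then x else y) = y by move=> [].
case: (lerP t N) => h1.
  case: (lerP t K) => h2; first by rewrite ifT //; lra.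
  case: (lerP t (K + 1)) => h3; first by rewrite ifT //; nra.
  by rewrite ifT //; lra.
rewrite (ifF' (t <= K)); last by lra.
rewrite (ifF' (t <= K + 1)); last by lra.
case: (lerP t (N + 1)) => h4.
  rewrite ifF'; last by rewrite -ltNge; nra.
  rewrite ifF'; last by rewrite -ltNge; nra.
  rewrite ifF'; last by lra.
  rewrite ifT; last by lra.
  ring.
rewrite ifF'; last by lra.
rewrite ifF'; last by lra.
rewrite ifF'; last by lra.
rewrite ifF'; last by lra.
by [].
Qed.

Lemma pl_word_equiv q u v : fp_equiv q.+1 u v -> pl_word q u =1 pl_word q v.
Proof.
elim=> {u v} [w|u v _ IH|u v w _ IH1 _ IH2|a b u v _ IH|i e|n k kn] t //.
- by rewrite IH1.
- by rewrite !pl_word_cat IH.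
- exact: pl_letterK.
- by rewrite /= pl_letter_rel //; congr (pl_letter _ (_, _) _); lia.
Qed.

Lemma pl_letter_inj q l : injective (pl_letter q l).
Proof. by case: l => i e; apply: can_inj (pl_letterK q i e). Qed.

Lemma pl_word_inj q w : injective (pl_word q w).
Proof.
by elim: w => [|l w IH] s t //= /IH; exact: pl_letter_inj.
Qed.

(** * Action on integer points *)

Lemma pl_letter_le q k e (t : int) : t <= k%:Z -> pl_letter q (k, e) t%:~R = t%:~R.
Proof. by move=> h; rewrite /pl_letter /= ifT // [k%:R]pmulrn ler_int. Qed.

(** An integer above [k] is at least [k + 1], so it avoids the interior of the sloped interval; at
    [k + 1] the two formulas agree. *)
Lemma pl_letter_gt_true q k (t : int) :
  k%:Z < t -> pl_letter q (k, true) t%:~R = (t + q%:Z)%:~R.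
Proof.
move=> h; have h1 : (k%:R + 1 : rat) <= t%:~R.
  by rewrite [k%:R]pmulrn -[1]/(1%:~R) -intrD ler_int; lia.
rewrite /pl_letter /= ifF; last by apply/negbTE; lra.
rewrite intrD; case: lerP => h2; last by [].
have -> : (t%:~R : rat) = k%:R + 1 by lra.
by rewrite -[q%:~R]pmulrn; ring.
Qed.

Lemma pl_letter_gt_false q k (t : int) :
  k%:Z + q%:Z < t -> pl_letter q (k, false) t%:~R = (t - q%:Z)%:~R.
Proof.
move=> h; apply: (@pl_letter_inj q (k, true)).
rewrite (pl_letterK q k false) pl_letter_gt_true; last by lia.
by rewrite subrK.
Qed.

(** The threshold is an integer because test points to the left of a letter may be negative. *)
Definition cntz (b : bool) (t : int) (w : word) : nat :=
  count (fun l => (l.2 == b) && (l.1%:Z < t)) w.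

Lemma cntz_size b c t w : b != c -> (cntz b t w + cntz c t w <= size w)%N.
Proof.
move=> bc; rewrite /cntz; elim: w => //= -[i e] w IH /=.
by case: (_ < t); case: b c e bc IH => [] [] [] //= _; lia.
Qed.

(** Each letter moves the point by at most [q], so the orbit stays inside the letter-free gap around
    [t0], where every letter translates by [q], [-q] or [0]. The extra [q.+1] serves inverse
    letters, which translate integers only above [k + q]. *)
Lemma pl_word_far q (w : word) (t0 t : int) (B : nat) :
  all (fun l => (l.1%:Z + B%:Z < t0) || (t0 + B%:Z < l.1%:Z)) w ->
  t + (q * size w + q.+1)%:Z <= t0 + B%:Z ->
  t0 + (q * size w + q.+1)%:Z <= t + B%:Z ->
  pl_word q w t%:~R =
    (t + (q * cntz true t0 w)%:Z - (q * cntz false t0 w)%:Z)%:~R.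
Proof.
elim: w t => [|[k e] w IH] t /=; first by rewrite !muln0 => _ _ _; congr _%:~R; lia.
case/andP=> hk hw ht1 ht2.
have qS : (q * (size w).+1 = q * size w + q)%N by rewrite mulnS addnC.
rewrite qS in ht1 ht2; rewrite /cntz /= -!/(cntz _ _ _).
have [kt|kt] := ltP (k%:Z) t0; last first.
  rewrite pl_letter_le; last by lia.
  rewrite IH //; [|lia|lia].
  by rewrite !andbF !add0n.
case: e => /=; rewrite ?add0n ?mulnDr ?muln1.
  rewrite pl_letter_gt_true; last by lia.
  by rewrite IH //; [congr _%:~R; lia | lia | lia].
rewrite pl_letter_gt_false; last by lia.
by rewrite IH //; [congr _%:~R; lia | lia | lia].
Qed.

(** * Trivial words *)

Lemma count0_all (T : Type) (a : pred T) s : count a s = 0%N -> all (predC a) s.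
Proof. by move=> h; rewrite all_predC has_count h. Qed.

Lemma cntz_cat b t u v : cntz b t (u ++ v) = (cntz b t u + cntz b t v)%N.
Proof. exact: count_cat. Qed.

Lemma cntz_cons b t k e w :
  cntz b t ((k, e) :: w) = (((e == b) && (k%:Z < t)%R) + cntz b t w)%N.
Proof. by []. Qed.

Lemma eq_cntz b (s t : int) w :
  all (fun l => (l.1%:Z < s) == (l.1%:Z < t)) w -> cntz b s w = cntz b t w.
Proof.
by move=> /allP h; apply: eq_in_count => l /h /eqP ->.
Qed.

(** A trivial word fixes [t], while [pl_word_far] moves it by [q] times the difference of the two
    counts. *)
Lemma trivial_cntz q w M (t : int) :
  fp_equiv q.+1 w [::] -> (0 < q)%N -> (q * size w + q.+1 <= M)%N ->
  all (fun l => (l.1%:Z + M%:Z < t) || (t + M%:Z < l.1%:Z)) w ->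
  cntz true t w = cntz false t w.
Proof.
move=> /pl_word_equiv /(_ t%:~R) + q0 hM far.
rewrite (pl_word_far far); [|lia|lia].
move=> /intr_inj h; apply/eqP; rewrite -(eqn_pmul2l q0); lia.
Qed.

Definition close (K a b : nat) : bool := ((a <= b + K) && (b <= a + K))%N.

Definition count_close (K k : nat) (w : word) : nat := count (fun l => close K k l.1) w.

Lemma trivial_close q w M K x :
  fp_equiv q.+1 w [::] -> (0 < q)%N -> (q * size w + q.+1 <= M)%N ->
  (2 * M + 2 <= K)%N -> x \in w -> (2 <= count_close K x.1 w)%N.
Proof.
(* The exponent sums below two points on either side of an isolated letter
   would differ by one. *)
move=> triv q0 + hK xw; case/splitPr: xw triv => u z triv hM.
case: x triv hM => k e triv hM; rewrite leqNgt; apply/negP => lt2.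
have : count_close K k (u ++ z) = 0%N.
  move: lt2; rewrite /count_close !count_cat /= {2}/close.
  have -> : (k <= k + K)%N by lia.
  by rewrite /=; lia.
move=> /count0_all /allP far.
have eqc b : cntz b (k%:Z - M%:Z - 1) (u ++ z) = cntz b (k%:Z + M%:Z + 1) (u ++ z).
  by apply: eq_cntz; apply/allP => l /far /=; rewrite /close; lia.
have H t : (t = k%:Z - M%:Z - 1 \/ t = k%:Z + M%:Z + 1) ->
    cntz true t (u ++ (k, e) :: z) = cntz false t (u ++ (k, e) :: z).
  move=> ht; apply: (trivial_cntz triv q0 hM); apply/allP => l.
  have [->|lk] := eqVneq l (k, e); first by case: ht => -> /= _; lia.
  rewrite mem_cat inE (negbTE lk) /= -mem_cat => /far /=; rewrite /close.
  by case: ht => ->; lia.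
have := H _ (or_introl erefl); have := H _ (or_intror erefl).
move: (eqc true) (eqc false); rewrite !cntz_cat !cntz_cons.
by case: e {triv hM H lt2} => /=; lia.
Qed.

Lemma pl_letter_fix q k e t : (0 < q)%N -> pl_letter q (k, e) t = t -> t <= k%:R.
Proof.
move=> q0 h; have {h} : pl_letter q (k, true) t = t.
  by case: e h => // h; rewrite -{1}h (pl_letterK q k false).
have q1 : (0 : rat) < q%:R by rewrite ltr0n.
rewrite /pl_letter /=; case: lerP => // h1; case: lerP => h2; nra.
Qed.

Lemma cntz_budget q t w :
  (q * cntz true t w + q * cntz false t w <= q * size w)%N.
Proof. by rewrite -mulnDr leq_mul2l cntz_size ?orbT. Qed.

(** The equation says that [b] is the index reached by the first letter when it is pushed right
    through [v]. The signs are opposite because the exponent sums vanish on both sides of the pair;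
    the equation comes from two inequalities, each found by tracking one integer point through
    [w]. *)
Lemma trivial_pair q M K (u v z : word) a b e e' :
  let w : word := u ++ (a, e) :: v ++ (b, e') :: z in
  fp_equiv q.+1 w [::] -> (0 < q)%N -> (q * size w + q.+1 <= M)%N ->
  (2 * M + 2 <= K)%N -> close K a b ->
  all (fun l => ~~ close K a l.1 && ~~ close K b l.1) (u ++ v ++ z) ->
  e' = ~~ e /\ (b + q * cntz false a v = a + q * cntz true a v)%N.
Proof.
move=> w triv q0 hM hK ab /allP far.
(* Thresholds just outside the pair divide the remaining letters exactly as the threshold [a]
   does. *)
have eqc b' (t : int) (s : word) : {subset s <= u ++ v ++ z} ->
   (t = (minn a b)%:Z - M%:Z - 1 \/ t = (maxn a b)%:Z + M%:Z + 1) ->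
   cntz b' t s = cntz b' a s.
  move=> sub ht; apply: eq_cntz; apply/allP => l /sub /far /=.
  by move: ab; rewrite /close; case: ht => ->; lia.
have su : {subset u <= u ++ v ++ z} by move=> l; rewrite mem_cat => ->.
have sv : {subset v <= u ++ v ++ z} by move=> l; rewrite !mem_cat orbC => ->.
have sz : {subset z <= u ++ v ++ z} by move=> l; rewrite !mem_cat orbA orbC => ->.
have H (t : int) : (t = (minn a b)%:Z - M%:Z - 1 \/ t = (maxn a b)%:Z + M%:Z + 1) ->
    cntz true t w = cntz false t w.
  move=> ht; apply: (trivial_cntz triv q0 hM); apply/allP => l.
  have [->|la] := eqVneq l (a, e); first by case: ht => -> /= _; lia.
  have [->|lb] := eqVneq l (b, e'); first by case: ht => -> /= _; lia.
  have : l \in w -> l \in u ++ v ++ z.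
    by rewrite /w !(mem_cat, inE) (negbTE la) (negbTE lb).
  move=> /[apply] /far; move: ab; rewrite /close /=.
  by case: ht => ->; lia.
have h1 := H _ (or_introl erefl); have h2 := H _ (or_intror erefl).
have ee : e' = ~~ e.
  move: h1 h2; rewrite /w !(cntz_cat, cntz_cons).
  rewrite !(eqc _ _ u su (or_introl erefl)) !(eqc _ _ v sv (or_introl erefl)).
  rewrite !(eqc _ _ z sz (or_introl erefl)).
  rewrite !(eqc _ _ u su (or_intror erefl)) !(eqc _ _ v sv (or_intror erefl)).
  rewrite !(eqc _ _ z sz (or_intror erefl)).
  by case: (e) (e') => [] [] //=; lia.
split=> //.
have h3 : (cntz true a u + cntz true a v + cntz true a z =
           cntz false a u + cntz false a v + cntz false a z)%N.
  move: h1; rewrite /w !(cntz_cat, cntz_cons).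
  rewrite !(eqc _ _ u su (or_introl erefl)) !(eqc _ _ v sv (or_introl erefl)).
  rewrite !(eqc _ _ z sz (or_introl erefl)).
  have -> : (a%:Z < (minn a b)%:Z - M%:Z - 1) = false by lia.
  have -> : (b%:Z < (minn a b)%:Z - M%:Z - 1) = false by lia.
  by rewrite !andbF; lia.
have h3q : (q * cntz true a u + q * cntz true a v + q * cntz true a z =
           q * cntz false a u + q * cntz false a v + q * cntz false a z)%N.
  by rewrite -!mulnDr h3.
have [szu [szv szz]] : (q * size u <= q * size w /\ q * size v <= q * size w /\
    q * size z <= q * size w)%N.
  by rewrite !leq_mul2l /w !size_cat /= size_cat /=; split; [|split]; apply/orP; lia.
have cu := cntz_budget q a u.
have cv := cntz_budget q a v.
have cz := cntz_budget q a z.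
have tr (s : word) (t : int) : {subset s <= u ++ v ++ z} -> (q * size s <= q * size w)%N ->
    t <= a%:Z + (q * size w + q.+1)%:Z ->
    a%:Z <= t + (q * size w + q.+1)%:Z ->
    pl_word q s t%:~R = (t + (q * cntz true a s)%:Z - (q * cntz false a s)%:Z)%:~R.
  move=> sub hs ht1 ht2; apply: (@pl_word_far q s a%:Z t K); [|lia|lia].
  by apply/allP => l /sub /far; rewrite /close; lia.
have act_w (t : rat) : pl_word q z (pl_letter q (b, e') (pl_word q v
    (pl_letter q (a, e) (pl_word q u t)))) = t.
  by have := pl_word_equiv triv t; rewrite /w pl_word_cat /= pl_word_cat.
(* The points [a] and [a + 1] of the line must return to their place under [w]. *)
have le1 : (a + q * cntz true a v <= b + q * cntz false a v)%N.
  have := act_w (a%:Z - (q * cntz true a u)%:Z + (q * cntz false a u)%:Z)%:~R.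
  rewrite (tr u) //; [|lia|lia].
  rewrite [X in pl_letter q (a, e) X%:~R](_ : _ = a%:Z); last by lia.
  rewrite pl_letter_le // (tr v) //; [|lia|lia].
  set t' := (_ - _ : int) => h.
  (* Already [z] alone sends [t'] back to the start, so by injectivity the second letter fixes [t'];
     a letter fixes no point above its index. *)
  have : pl_word q z t'%:~R =
    (a%:Z - (q * cntz true a u)%:Z + (q * cntz false a u)%:Z)%:~R.
    by rewrite (tr z) //; [congr _%:~R; lia | lia | lia].
  rewrite -[RHS]h => /pl_word_inj /esym /(pl_letter_fix q0).
  by rewrite [b%:R]pmulrn ler_int; lia.
suff le2 : (b + q * cntz false a v <= a + q * cntz true a v)%N.
  by apply/eqP; rewrite eqn_leq le1 le2.
(* The start makes the first letter go between [a + 1] and [a + 1 + q], in the direction given by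
   its sign. For either sign [x_b] must then send [t'] to [t' + q], which forces [b < t']. *)
have := act_w (a%:Z + (1 + (if e then 0 else q))%:Z - (q * cntz true a u)%:Z
               + (q * cntz false a u)%:Z)%:~R.
rewrite (tr u) //; [|case: ifP; lia|case: ifP; lia].
rewrite [X in pl_letter q (a, e) X%:~R](_ : _ = a%:Z + (1 + (if e then 0 else q))%:Z);
  last by lia.
have -> : pl_letter q (a, e) (a%:Z + (1 + (if e then 0 else q))%:Z)%:~R =
          (a%:Z + 1 + (if e then q else 0%N)%:Z)%:~R.
  case: (e); first by rewrite pl_letter_gt_true; [congr _%:~R; lia | lia].
  by rewrite pl_letter_gt_false; [congr _%:~R; lia | lia].
rewrite (tr v) //; [|case: ifP; lia|case: ifP; lia].
set t' := (a%:Z + 1 + (q * cntz true a v)%:Z - (q * cntz false a v)%:Z).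
rewrite [X in pl_letter q (b, e') X%:~R](_ : _ = t' + (if e then q else 0%N)%:Z);
  last by lia.
move=> h.
have : pl_word q z (t' + (if e then 0%N else q)%:Z)%:~R =
   (a%:Z + (1 + (if e then 0 else q))%:Z - (q * cntz true a u)%:Z
               + (q * cntz false a u)%:Z)%:~R.
  by rewrite (tr z) //; [congr _%:~R; case: ifP; lia | case: ifP; lia | case: ifP; lia].
rewrite -[RHS]h => /pl_word_inj {}h.
have {}h : pl_letter q (b, true) t'%:~R = (t' + q%:Z)%:~R.
  move: h; rewrite ee; case: (e) => /=; rewrite !addr0; last by move=> ->.
  by move=> ->; rewrite (pl_letterK q b false).
have [tb|bt] := lerP t' b%:Z; last by lia.
by move: h; rewrite pl_letter_le // => /intr_inj; lia.
Qed.

(** * Unpaired words are negligible *)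

Local Open Scope nat_scope.

Lemma close_sym K a b : close K a b = close K b a.
Proof. by rewrite /close andbC. Qed.

Lemma close_refl K a : close K a a.
Proof. by rewrite /close leq_addr. Qed.

(** Greedy choice: a point is kept only if no point chosen so far is within [D]. Starting from [k0]
    guarantees that [k0] is a centre. *)
Lemma separated_cover D k0 (s : seq nat) :
  exists c, [/\ k0 \in c, {subset c <= k0 :: s},
    pairwise (fun a b => ~~ close D a b) c & all (fun k => has (close D k) c) s].
Proof.
elim: s => [|k s [c [k0c sub sep cov]]]; first by exists [:: k0]; split => //; exact: mem_head.
have sub' : {subset c <= k0 :: k :: s}.
  by move=> m /sub; rewrite !inE => /orP[->|->]; rewrite ?orbT.
have [kc|kc] := boolP (has (close D k) c).
  by exists c; split => //=; rewrite kc.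
exists (k :: c); split => /=.
- by rewrite inE k0c orbT.
- by move=> m; rewrite inE => /orP[/eqP ->|/sub' //]; rewrite !inE eqxx orbT.
- by rewrite sep andbT all_predC.
- by rewrite close_refl /=; apply: sub_all cov => m /= ->; rewrite orbT.
Qed.

(** Balls of radius [K] around centres more than [2 * K] apart are disjoint, so no letter is counted
    twice. *)
Lemma sum_count_close K (c : seq nat) (w : word) :
  pairwise (fun a b => ~~ close (2 * K) a b) c ->
  \sum_(m <- c) count_close K m w <= size w.
Proof.
move=> sep; apply: leq_trans (count_size (fun l => has (fun m => close K m l.1) c) w).
elim: c sep => [|m c IH] /=; first by rewrite big_nil.
case/andP => /allP mc /IH {}IH; rewrite big_cons.
rewrite (eq_count (a2 := predU (fun l : letter => close K m l.1)
  (fun l => has (fun m' => close K m' l.1) c))) //.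
have disj : count (predI (fun l : letter => close K m l.1)
    (fun l => has (fun m' => close K m' l.1) c)) w = 0.
  apply/eqP; rewrite eqn0Ngt -has_count; apply/hasPn => l _ /=.
  apply/negP => /andP[ml /hasP[m' /mc]]; move: ml; rewrite /close; lia.
have := count_predUI (fun l : letter => close K m l.1)
  (fun l => has (fun m' => close K m' l.1) c) w.
by rewrite disj addn0 => ->; exact: leq_add.
Qed.

(** The count includes the letter itself, so [2] means exactly one companion. *)
Definition paired (K : nat) (w : word) : bool := all (fun x => count_close K x.1 w == 2) w.

Lemma unpaired_cover K (w : word) :
  (forall x, x \in w -> 2 <= count_close K x.1 w) -> ~~ paired K w ->
  exists c, [/\ {subset c <= map fst w}, 2 * size c < size w
    & all (fun x => has (close (2 * K) x.1) c) w].
Proof.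
move=> ge2 /allPn[x xw x3].
(* The balls of radius [K] around the points of a separated cover are disjoint;
   each contains two letters and the one around [x] contains three. *)
have [c [xc sub sep cov]] := separated_cover (2 * K) x.1 (map fst w).
have sub' : {subset c <= map fst w}.
  by move=> m /sub; rewrite inE => /orP[/eqP ->|//]; exact: map_f.
exists c; split => //; last by move: cov; rewrite all_map.
apply: leq_trans (sum_count_close w sep).
have {}ge2 m : m \in c -> 2 <= count_close K m w by move=> /sub' /mapP[y yw ->]; exact: ge2.
have /perm_to_rem pc := xc.
rewrite (perm_big _ pc) (perm_size pc) /= big_cons.
have gt2 : 2 < count_close K x.1 w by rewrite ltn_neqAle eq_sym x3 ge2.
have : 2 * size (rem x.1 c) <= \sum_(m <- rem x.1 c) count_close K m w.
  have : {subset rem x.1 c <= c} by exact: mem_rem.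
  elim: (rem x.1 c) => [|m s IH] h /=; first by rewrite big_nil.
  rewrite big_cons mulnS leq_add ?ge2 ?h ?mem_head //.
  by apply: IH => m' m's; rewrite h // inE m's orbT.
by move=> le; rewrite mulnS -addSn; exact: leq_add.
Qed.

(** The offset [o.1] runs from [0] to [2 * L] and encodes a displacement between [-L] and [L].
    Repetitions caused by truncation are harmless, since only an upper bound is wanted. *)
Definition nbhd (L : nat) (c : seq nat) : seq letter :=
  [seq (m + o.1 - L, o.2) | m <- c, o <- alph (2 * L + 1)].

Lemma mem_nbhd L c x : has (close L x.1) c -> x \in nbhd L c.
Proof.
case: x => k e /hasP[m mc] /= /andP[km mk]; apply/allpairsP.
exists (m, (k + L - m, e)); split => //=; last by congr pair; lia.
rewrite mem_alph /=. lia.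
Qed.

Definition coverable (n r L d : nat) : seq word :=
  [seq w | c <- words (iota 0 n) r, w <- words (nbhd L c) d].

Lemma size_coverable n r L d :
  size (coverable n r L d) = n ^ r * (r * size (alph (2 * L + 1))) ^ d.
Proof.
rewrite /coverable size_allpairs_dep.
have /all_pred1P -> : all (pred1 ((r * size (alph (2 * L + 1))) ^ d))
    [seq size (words (nbhd L c) d) | c <- words (iota 0 n) r].
  rewrite all_map; apply/allP => c; rewrite mem_words => /andP[/eqP cr _].
  by rewrite /= size_words size_allpairs cr.
by rewrite sumn_nseq mulnC size_map size_words size_iota.
Qed.

Lemma mem_coverable n L d (c : seq nat) (w : word) :
  0 < n -> w \in words (alph n) d -> {subset c <= map fst w} ->
  2 * size c < size w -> all (fun x => has (close L x.1) c) w ->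
  w \in coverable n d.-1./2 L d.
Proof.
move=> n0; rewrite mem_words_alph => /andP[/eqP wd /allP wn] sub cd cov.
(* The centres number at most [d.-1./2]; padding with the centre [0] makes the length exact. *)
apply/allpairsPdep; exists (c ++ nseq (d.-1./2 - size c) 0), w; split => //.
- rewrite mem_words size_cat size_nseq subnKC; last by move: cd; rewrite wd; move: (size c); lia.
  rewrite eqxx all_cat all_nseq /= mem_iota n0 orbT andbT.
  by apply/allP => m /sub /mapP[x /wn xn ->]; rewrite /= mem_iota.
- rewrite mem_words wd eqxx; apply: sub_all cov => x h /=.
  by apply: mem_nbhd; rewrite has_cat h.
Qed.

(** Serves for trivial words and for ideal words alike. The covering balls have radius [2 * K],
    hence the [4 * K + 1] offsets. *)
Lemma count_paired n d K (P : pred word) :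
  0 < n ->
  (forall w, P w -> size w = d -> forall x, x \in w -> 2 <= count_close K x.1 w) ->
  count P (words (alph n) d) <=
    count (fun w => P w && paired K w) (words (alph n) d)
    + n ^ d.-1./2 * (d.-1./2 * size (alph (4 * K + 1))) ^ d.
Proof.
move=> n0 ge2.
rewrite -!size_filter -(count_predC (paired K) (seq.filter _ _)) -size_filter -filter_predI.
rewrite (eq_filter (a1 := predI _ _) (a2 := fun w => P w && paired K w));
  last by move=> w /=; rewrite andbC.
rewrite leq_add2l -size_filter -filter_predI.
have -> : 4 * K = 2 * (2 * K) by rewrite mulnA.
rewrite -size_coverable; apply: uniq_leq_size.
  by rewrite filter_uniq // words_uniq // alph_uniq.
move=> w; rewrite mem_filter /= => /andP[/andP[unp Pw] win].
have /andP[/eqP wd _] : (size w == d) && all (fun l => l.1 < n) w.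
  by rewrite -mem_words_alph.
have [c [sub cd cov]] := unpaired_cover (ge2 w Pw wd) unp.
exact: mem_coverable cov.
Qed.

(** * Shifted words *)

(* The slack [L] exceeds the index gap inside a pair, so that the two letters of
   a pair do not count each other. *)
Definition cnt (L : nat) (b : bool) (k : nat) (w : word) : nat :=
  count (fun l => (l.2 == b) && (l.1 + L < k)) w.

(* With [s = true] this is the letter obtained by pushing [x] to the right past
   the lower letters of [t]; [s = false] is the opposite move.  The offset [M]
   keeps the truncated subtraction from truncating. *)
Definition shift_letter (q M L : nat) (s : bool) (x : letter) (t : word) : letter :=
  (x.1 + M + q * cnt L s x.1 t - q * cnt L (~~ s) x.1 t, x.2).

(** The argument [t] is the context following [w]. Each letter is shifted against the original
    letters on its right, not the shifted ones. *)
Fixpoint shift_word (q M L : nat) (s : bool) (w t : word) : word :=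
  if w is x :: w' then shift_letter q M L s x (w' ++ t) :: shift_word q M L s w' t else [::].

Lemma cnt_cat L b k u v : cnt L b k (u ++ v) = cnt L b k u + cnt L b k v.
Proof. exact: count_cat. Qed.

Lemma cnt_cons L b k x w : cnt L b k (x :: w) = ((x.2 == b) && (x.1 + L < k)) + cnt L b k w.
Proof. by []. Qed.

Lemma cnt_budget q L b k w : q * cnt L b k w <= q * size w.
Proof. by rewrite leq_mul2l count_size orbT. Qed.

Lemma shift_cat q M L s u v t :
  shift_word q M L s (u ++ v) t = shift_word q M L s u (v ++ t) ++ shift_word q M L s v t.
Proof. by elim: u => //= x u ->; rewrite catA. Qed.

Lemma size_shift q M L s w t : size (shift_word q M L s w t) = size w.
Proof. by elim: w => //= x w ->. Qed.

Lemma mem_shift q M L s w t y : y \in shift_word q M L s w t ->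
  exists u x v, w = u ++ x :: v /\ y = shift_letter q M L s x (v ++ t).
Proof.
elim: w => //= x w IH; rewrite inE => /orP[/eqP ->|/IH[u [x' [v [-> ->]]]]].
  by exists [::], x, w.
by exists (x :: u), x', v.
Qed.

Lemma shift_letter_mem q M L s u x v t :
  shift_letter q M L s x (v ++ t) \in shift_word q M L s (u ++ x :: v) t.
Proof. by rewrite shift_cat mem_cat /= mem_head orbT. Qed.

Lemma shift_letter_bound q M L s x t : q * size t <= M ->
  x.1 <= (shift_letter q M L s x t).1 <= x.1 + 2 * M.
Proof.
move=> h; have := cnt_budget q L s x.1 t; have := cnt_budget q L (~~ s) x.1 t.
by rewrite /=; lia.
Qed.

(** Decode from the right: once the tails agree, two heads with equal shifts lie within [2 * M] of
    each other, and no tail letter can tell them apart. *)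
Lemma shift_inj q M L K s w1 w2 :
  q * size w1 <= M -> 3 * M <= L -> L + 2 * M <= K ->
  (forall x y, x \in w1 -> y \in w1 -> close M x.1 y.1 || ~~ close K x.1 y.1) ->
  shift_word q M L s w1 [::] = shift_word q M L s w2 [::] -> w1 = w2.
Proof.
move=> hM hL hK; elim: w1 w2 hM => [|x w1 IH] [|y w2] //=; rewrite mulnS => hM sep [hk he /IH tl].
have hM' : q * size w1 <= M by apply: leq_trans hM; exact: leq_addl.
have {}tl : w1 = w2.
  by apply: tl => [|a b aw bw]; [exact: hM' | apply: sep; rewrite inE ?aw ?bw orbT].
subst w2; congr cons; rewrite !cats0 in hk.
have hx := shift_letter_bound L s x hM'; have hy := shift_letter_bound L s y hM'.
rewrite /= hk in hx; rewrite /= in hy.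
(* A tail letter within [M] of [x] is counted for neither head, since [3 * M <= L]; one beyond [K]
   falls on the same side of both thresholds, since [L + 2 * M <= K]. *)
have eqc b : cnt L b x.1 w1 = cnt L b y.1 w1.
  apply: eq_in_count => l lw; congr andb.
  have /sep : l \in x :: w1 by rewrite inE lw orbT.
  move=> /(_ x (mem_head _ _)); rewrite /close.
  case: x y l hx hy {sep hk he IH lw} => [a ?] [b' ?] [c ?] /=; lia.
rewrite !eqc in hk.
have := leq_trans (cnt_budget q L s y.1 w1) hM'.
have := leq_trans (cnt_budget q L (~~ s) y.1 w1) hM'.
move: hk he {sep hx hy eqc IH}; case: x y => [a ea] [b eb] /=.
by move=> hk -> h1 h2; congr pair; lia.
Qed.

(** * From trivial paired words to ideal words *)

Definition inv_letter (x : letter) : letter := (x.1, ~~ x.2).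

Definition ideal (w : word) : bool := uniq w && all (fun x => inv_letter x \in w) w.

Lemma inv_letterK : involutive inv_letter.
Proof. by case=> k e; rewrite /inv_letter /= negbK. Qed.

Lemma paired_split K w u x z : paired K w -> w = u ++ x :: z ->
  (exists v y z', z = v ++ y :: z' /\ close K x.1 y.1) \/
  (exists u' y v, u = u' ++ y :: v /\ close K x.1 y.1).
Proof.
move=> + wE; rewrite wE => /allP /(_ x); rewrite mem_cat mem_head orbT => /(_ isT) /=.
rewrite /count_close count_cat /= close_refl => /eqP h.
have spl (s : word) : has (fun l => close K x.1 l.1) s ->
    exists v y z', s = v ++ y :: z' /\ close K x.1 y.1.
  by case/hasP => y /splitPr[v z'] xy; exists v, y, z'.
have [zx|zx] := boolP (has (fun l => close K x.1 l.1) z); first by left; exact: spl.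
by right; apply: spl; move: zx; rewrite !has_count; lia.
Qed.

(** The letters [x] and [y] already exhaust the count of two around each of them. *)
Lemma paired_far K u x v y z :
  paired K (u ++ x :: v ++ y :: z) -> close K x.1 y.1 ->
  all (fun l => ~~ close K x.1 l.1 && ~~ close K y.1 l.1) (u ++ v ++ z).
Proof.
move=> /allP pw xy.
have /pw : x \in u ++ x :: v ++ y :: z by rewrite mem_cat mem_head orbT.
have /pw : y \in u ++ x :: v ++ y :: z by rewrite !(mem_cat, inE) eqxx !orbT.
have yx : close K y.1 x.1 by rewrite close_sym.
rewrite /count_close !count_cat /= !count_cat /= !close_refl xy yx => /eqP hy /eqP hx.
have zy : count (fun l => close K y.1 l.1) (u ++ v ++ z) = 0 by rewrite !count_cat; lia.
have zx : count (fun l => close K x.1 l.1) (u ++ v ++ z) = 0 by rewrite !count_cat; lia.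
apply/allP => l lw; have /allP/(_ l lw) /= -> := count0_all zy.
by have /allP/(_ l lw) /= -> := count0_all zx.
Qed.

Lemma shift_uniq q M L s w t :
  (forall u x v y z, w = u ++ x :: v ++ y :: z ->
     shift_letter q M L s x (v ++ y :: z ++ t) <> shift_letter q M L s y (z ++ t)) ->
  uniq (shift_word q M L s w t).
Proof.
elim: w => //= x w IH h; rewrite IH ?andbT; last first.
  by move=> u x' v y z wE; apply: (h (x :: u) x' v y z); rewrite wE.
apply/negP => /mem_shift[v [y [z [wE]]]].
by rewrite wE -catA; apply: (h [::] x v y z); rewrite wE.
Qed.

(** By [trivial_pair], pushing [x] past [v] brings it to the index of [y]; the letters of [z] are
    far from both and then shift both alike. *)
Lemma trivial_paired_pair q M K u x v y z (w := u ++ x :: v ++ y :: z) :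
  fp_equiv q.+1 w [::] -> 0 < q -> q * size w + q.+1 <= M -> 2 * M + 2 <= K ->
  paired K w -> close K x.1 y.1 ->
  [/\ y = (y.1, ~~ x.2), close M x.1 y.1 &
    forall L, L <= K -> M <= L ->
      shift_letter q M L true y z = inv_letter (shift_letter q M L true x (v ++ y :: z))].
Proof.
move=> triv q0 hM hK pw xy; have /allP far := paired_far pw xy.
case: x y @w triv hM pw xy far => [a e] [b e'] w triv hM pw /= xy far.
have /(trivial_pair triv q0 hM hK xy) [ee ab] :
  all (fun l => ~~ close K a l.1 && ~~ close K b l.1) (u ++ v ++ z) by exact/allP.
have szs : q * size v + q * size z <= q * size w.
  by rewrite -mulnDr leq_mul2l /w size_cat /= size_cat /=; apply/orP; lia.
have bv := cntz_budget q a v.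
split; [by rewrite ee | by rewrite /close; lia |].
move=> L LK ML; rewrite /inv_letter /shift_letter /= ee; congr pair.
rewrite !cnt_cat !cnt_cons /=.
have -> : (b + L < a) = false by lia.
rewrite !andbF !add0n.
have vE c : cnt L c a v = cntz c a v.
  apply: eq_in_count => l lv; congr andb.
  have /far : l \in u ++ v ++ z by rewrite !mem_cat lv orbT.
  by rewrite /close; case: l {lv} => k ? /=; lia.
have zE c : cnt L c a z = cnt L c b z.
  apply: eq_in_count => l lz; congr andb.
  have /far : l \in u ++ v ++ z by rewrite !mem_cat lz !orbT.
  by move: xy; rewrite /close; case: l {lz} => k ? /=; lia.
rewrite !vE !zE !mulnDr.
have := cnt_budget q L true b z; have := cnt_budget q L false b z.
lia.
Qed.

(** Provides the separation hypothesis of [shift_inj]. *)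
Lemma trivial_paired_sep q M K w :
  fp_equiv q.+1 w [::] -> 0 < q -> q * size w + q.+1 <= M -> 2 * M + 2 <= K ->
  paired K w ->
  forall x y, x \in w -> y \in w -> close M x.1 y.1 || ~~ close K x.1 y.1.
Proof.
move=> triv q0 hM hK pw x y xw yw.
have [xy|_] := boolP (close K x.1 y.1); last by rewrite orbT.
suff -> : close M x.1 y.1 by [].
have [->|yx] := eqVneq y x; first exact: close_refl.
case/splitPr: xw triv hM pw yw => u t triv hM pw.
rewrite mem_cat inE (negbTE yx) /= => /orP[yu|yt].
  case/splitPr: yu triv hM pw => u' v; rewrite -catA /= => triv hM pw.
  rewrite close_sym; rewrite close_sym in xy.
  by have [_ -> _] := trivial_paired_pair triv q0 hM hK pw xy.
case/splitPr: yt triv hM pw => v z triv hM pw.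
by have [_ -> _] := trivial_paired_pair triv q0 hM hK pw xy.
Qed.

(** Two letters with equal shifts would have indices within [2 * M], hence form a pair, but a pair
    has opposite signs. The inverse of a shifted letter is its shifted companion. *)
Lemma trivial_shift_ideal q M L K w :
  fp_equiv q.+1 w [::] -> 0 < q -> q * size w + q.+1 <= M -> 2 * M + 2 <= K ->
  M <= L -> L <= K -> paired K w -> ideal (shift_word q M L true w [::]).
Proof.
move=> triv q0 hM hK ML LK pw; apply/andP; split.
  apply: shift_uniq => u x v y z wE; rewrite !cats0 => xyE.
  have hM' : q * size (v ++ y :: z) <= M.
    apply: leq_trans (leq_trans (leq_addr _ _) hM).
    by rewrite leq_mul2l wE [size (u ++ _)]size_cat (leq_trans (leqnSn _) (leq_addl _ _)) orbT.
  have hM'' : q * size z <= M.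
    apply: leq_trans hM'; rewrite leq_mul2l size_cat.
    by rewrite (leq_trans (leqnSn _) (leq_addl _ _)) orbT.
  have hx := shift_letter_bound L true x hM'.
  have hy := shift_letter_bound L true y hM''.
  have xy : close K x.1 y.1 by rewrite xyE in hx; rewrite /close; move: hx hy; move: (x.1) (y.1); lia.
  subst w; have [yE _ _] := trivial_paired_pair triv q0 hM hK pw xy.
  by move: (congr1 snd xyE); rewrite yE /=; case: (x.2).
apply/allP => y' /mem_shift[u [x [t [wE ->]]]]; rewrite cats0.
have [[v [y [z [tE xy]]]]|[u' [y [v [uE xy]]]]] := paired_split pw wE; subst.
  have [_ _ /(_ L LK ML) <-] := trivial_paired_pair triv q0 hM hK pw xy.
  by have := shift_letter_mem q M L true (u ++ x :: v) y z [::]; rewrite cats0 -catA.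
rewrite close_sym in xy; rewrite -catA /= in triv hM pw *.
have [_ _ /(_ L LK ML) ->] := trivial_paired_pair triv q0 hM hK pw xy.
rewrite inv_letterK.
by have := shift_letter_mem q M L true u' y (v ++ x :: t) [::]; rewrite cats0.
Qed.

(** * Ideal words give trivial words *)

Lemma fp_cat p u u' v v' :
  fp_equiv p u u' -> fp_equiv p v v' -> fp_equiv p (u ++ v) (u' ++ v').
Proof.
move=> uu vv; apply: (@fp_trans _ _ (u' ++ v)).
  by have := fp_ctx [::] v uu.
by have := fp_ctx u' [::] vv; rewrite !cats0.
Qed.

Lemma fp_cancel_inv p x : fp_equiv p [:: x; inv_letter x] [::].
Proof. by case: x => i e; exact: fp_cancel. Qed.

Lemma fp_cancel_inv' p x : fp_equiv p [:: inv_letter x; x] [::].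
Proof. by have := fp_cancel_inv p (inv_letter x); rewrite inv_letterK. Qed.

Lemma fp_swap_invl p a b c : fp_equiv p [:: a; b] [:: b; c] ->
  fp_equiv p [:: inv_letter a; b] [:: b; inv_letter c].
Proof.
move=> h; apply: (@fp_trans _ _ [:: inv_letter a; b; c; inv_letter c]).
  exact: fp_sym (fp_ctx [:: inv_letter a; b] [::] (fp_cancel_inv p c)).
apply: (@fp_trans _ _ [:: inv_letter a; a; b; inv_letter c]).
  exact: fp_sym (fp_ctx [:: inv_letter a] [:: inv_letter c] h).
exact: (fp_ctx [::] [:: b; inv_letter c] (fp_cancel_inv' p a)).
Qed.

Lemma fp_swap_invr p a b c : fp_equiv p [:: a; b] [:: b; c] ->
  fp_equiv p [:: c; inv_letter b] [:: inv_letter b; a].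
Proof.
move=> h; apply: (@fp_trans _ _ [:: inv_letter b; b; c; inv_letter b]).
  exact: fp_sym (fp_ctx [::] [:: c; inv_letter b] (fp_cancel_inv' p b)).
apply: (@fp_trans _ _ [:: inv_letter b; a; b; inv_letter b]).
  exact: fp_sym (fp_ctx [:: inv_letter b] [:: inv_letter b] h).
exact: (fp_ctx [:: inv_letter b; a] [::] (fp_cancel_inv p b)).
Qed.

(** Passing an inverse letter uses the defining relation at index [i - q], which must still exceed
    [k]. *)
Lemma fp_swap q i e k s : k + q < i ->
  fp_equiv q.+1 [:: (i, e); (k, s)] [:: (k, s); (if s then i + q else i - q, e)].
Proof.
have pos j e' : k < j -> fp_equiv q.+1 [:: (j, e'); (k, true)] [:: (k, true); (j + q, e')].
  move=> kj; have := fp_rel q.+1 kj; have -> : j + q.+1 - 1 = j + q by lia.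
  by case: e' => // /fp_swap_invl.
move=> ki; case: s; first by apply: pos; lia.
have kj : k < i - q by lia.
by have /fp_swap_invr := pos _ e kj; rewrite subnK //; lia.
Qed.

Definition sgn (b : bool) (w : word) : nat := count (fun l => l.2 == b) w.

(** Iterates [fp_swap]. The margin [B] absorbs a drift of [q] per step, so the moving letter stays
    above those it has yet to pass. *)
Lemma fp_push q B i e (v : word) :
  all (fun l => l.1 + B < i) v -> q * size v + q <= B ->
  fp_equiv q.+1 ((i, e) :: v) (v ++ [:: (i + q * sgn true v - q * sgn false v, e)]).
Proof.
elim: v i B => [|[k s] v IH] i B /=.
  by rewrite !muln0 addn0 subn0 => *; exact: fp_refl.
case/andP=> ki hv hB.
have qS : q * (size v).+1 = q * size v + q by rewrite mulnS addnC.
have c1 : q * sgn true v <= q * size v by rewrite leq_mul2l count_size orbT.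
have c2 : q * sgn false v <= q * size v by rewrite leq_mul2l count_size orbT.
rewrite qS in hB.
have kq : k + q < i by lia.
apply: (@fp_trans _ _ ((k, s) :: (if s then i + q else i - q, e) :: v)).
  exact: (fp_ctx [::] v (fp_swap e s kq)).
have /IH/(_ (leqnn _)) {}IH : all (fun l => l.1 + (q * size v + q) <
    (if s then i + q else i - q)) v.
  by apply: sub_all hv => l; case: s {IH}; lia.
have := fp_ctx [:: (k, s)] [::] IH; rewrite !cats0 /=.
congr (fp_equiv _ _ (_ :: _ ++ [:: (_, _)])).
by case: s {IH} => /=; rewrite /sgn /= -!/(sgn _ _) ?add0n ?mulnDr ?muln1; lia.
Qed.

Lemma eq_shift q M L s u t t' :
  (forall l b, l \in u -> cnt L b l.1 t = cnt L b l.1 t') ->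
  shift_word q M L s u t = shift_word q M L s u t'.
Proof.
elim: u => //= x u IH h; rewrite IH; last by move=> l b lu; apply: h; rewrite inE lu orbT.
by rewrite /shift_letter !cnt_cat !h ?mem_head.
Qed.

Lemma sgn_shift q M L s b w t : sgn b (shift_word q M L s w t) = sgn b w.
Proof. by rewrite /sgn; elim: w => //= x w ->. Qed.

Lemma exists_max (w : word) : w != [::] -> exists2 x, x \in w & forall y, y \in w -> y.1 <= x.1.
Proof.
elim: w => // x [|y w] IH _; first by exists x => [|z]; rewrite !inE // => /eqP ->.
have [//|m mw max] := IH.
have [xm|mx] := leqP x.1 m.1.
  by exists m; [rewrite inE mw orbT | move=> z; rewrite inE => /orP[/eqP->|/max]].
exists x; first exact: mem_head.
by move=> z; rewrite inE => /orP[/eqP->|/max h] //; apply: leq_trans h (ltnW mx).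
Qed.

Lemma two_split (T : eqType) (x y : T) s : x \in s -> y \in s -> x != y ->
  exists u v z, s = u ++ x :: v ++ y :: z \/ s = u ++ y :: v ++ x :: z.
Proof.
move=> /splitPr[u z]; rewrite mem_cat inE orbCA => /orP[/eqP ->|]; first by rewrite eqxx.
case/orP=> /splitPr[v t] _.
  by exists v, t, z; right; rewrite -catA.
by exists u, v, t; left.
Qed.

Lemma ideal_count_close K w x : ideal w -> x \in w -> 2 <= count_close K x.1 w.
Proof.
case/andP=> uw /allP inv xw; rewrite /count_close -size_filter.
apply: (@uniq_leq_size _ [:: x; inv_letter x]).
  by case: x {xw} => k e; rewrite /= inE andbT /inv_letter; apply/eqP => -[]; case: e.
move=> y; rewrite !inE mem_filter => /orP[/eqP->|/eqP->].
  by rewrite close_refl.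
by rewrite close_refl inv.
Qed.

(** The ball around [x] already holds [x] and its inverse; a letter of another index would be a
    third. *)
Lemma ideal_paired_sep K w x y :
  ideal w -> paired K w -> x \in w -> y \in w -> (x.1 == y.1) || ~~ close K x.1 y.1.
Proof.
case/andP=> uw /allP inv /allP pw xw yw; apply/orP.
have [|nxy] := eqVneq x.1 y.1; [by left | right]; apply/negP => xy.
have /eqP := pw x xw; rewrite /count_close -size_filter => sz.
have : 3 <= size (seq.filter (fun l => close K x.1 l.1) w); last by rewrite sz.
apply: (@uniq_leq_size _ [:: x; inv_letter x; y]).
  case: x y nxy {xw yw xy sz} => k e [m f] /= nxy.
  rewrite !inE /inv_letter /= !negb_or andbT -andbA; apply/and3P; split.
  - by apply/eqP => -[]; case: e.
  - by apply: contra nxy => /eqP[-> _].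
  - by apply: contra nxy => /eqP[-> _].
move=> z; rewrite !inE mem_filter => /or3P[] /eqP -> //.
- by rewrite close_refl.
- by rewrite close_refl inv.
- by rewrite xy.
Qed.

Lemma ideal_shift_trivial q M L K w :
  ideal w -> (forall x y, x \in w -> y \in w -> (x.1 == y.1) || ~~ close K x.1 y.1) ->
  q * size w + q <= M -> L <= K -> 3 * M <= K ->
  fp_equiv q.+1 (shift_word q M L false w [::]) [::].
Proof.
(* Push the first of the two letters of largest index to the right until it
   cancels the second; the other letters do not see these two. *)
move=> + + + LK MK; have [n] := ubnP (size w); elim: n w => // n IH w sw.
have [->|/exists_max[x xw max]] := eqVneq w [::]; first by move=> *; exact: fp_refl.
case/andP=> uw /allP inv sep hM.
have xx' : x != inv_letter x by case: (x) => k e; apply/eqP => -[]; case: e.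
have [e [u [v [z wE]]]] : exists (e : bool) (u v z : word), w = u ++ (x.1, e) :: v ++ (x.1, ~~ e) :: z.
  have [u [v [z [wE|wE]]]] := two_split xw (inv _ xw) xx'.
    by exists x.2, u, v, z; rewrite wE; case: (x).
  by exists (~~ x.2), u, v, z; rewrite wE negbK; case: (x).
move: x.1 xw max wE xx' => a _ max wE _.
have perm : perm_eq w [:: (a, e), (a, ~~ e) & u ++ v ++ z].
  by apply/permP => P; rewrite wE /= !count_cat /= !count_cat /=; lia.
have mw l : (l \in w) = [|| l == (a, e), l == (a, ~~ e) | l \in u ++ v ++ z].
  by rewrite (perm_mem perm) !inE.
move: uw; rewrite (perm_uniq perm) /= inE negb_or -andbA => /and4P[_ ae an uw'].
(* Uniqueness excludes the index [a]; maximality and separation then put every other letter more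
   than [K] below. *)
have low l : l \in u ++ v ++ z -> l.1 + K < a.
  move=> lw; have lw' : l \in w by rewrite mw lw !orbT.
  have aw : (a, e) \in w by rewrite mw eqxx.
  have := max _ lw'; have := sep _ _ lw' aw; rewrite /close /=.
  have la : l.1 != a.
    apply/eqP; case: l lw {lw'} => k f /= lw ka; subst k.
    have [fe|fe] := eqVneq f e; first by rewrite fe (negbTE ae) in lw.
    have fE : f = ~~ e by case: (f) (e) fe => [] [].
    by rewrite fE (negbTE an) in lw.
  by case: l la {lw lw'} => k f /=; lia.
have szw : q * size w = q * size v + q * size z + q * size u + q + q.
  have dist (i j k : nat) : q * (i + (j + k)).+2 = q * j + q * k + q * i + q + q by lia.
  by rewrite (perm_size perm) /= !size_cat; exact: dist.
have {IH} IH : fp_equiv q.+1 (shift_word q M L false (u ++ v ++ z) [::]) [::].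
  apply: IH.
  - by move: sw; rewrite (perm_size perm) /= ltnS; exact: ltnW.
  - rewrite /ideal uw'; apply/allP => l lw.
    have := inv l; rewrite !mw lw !orbT => /(_ isT) /or3P[] // /eqP le.
      by have := low _ lw; rewrite -[l.1]/((inv_letter l).1) le /=; lia.
    by have := low _ lw; rewrite -[l.1]/((inv_letter l).1) le /=; lia.
  - by move=> l l' lw lw'; apply: sep; rewrite mw ?lw ?lw' !orbT.
  - apply: leq_trans hM; rewrite leq_add2r leq_mul2l (perm_size perm) /=.
    by rewrite (leq_trans (leqnSn _) (leqnSn _)) orbT.
have lu l : l \in u -> l.1 + K < a by move=> lu; apply: low; rewrite mem_cat lu.
have lv l : l \in v -> l.1 + K < a by move=> lv; apply: low; rewrite !mem_cat lv orbT.
have cv b : cnt L b a v = sgn b v.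
  apply: eq_in_count => l /lv; case: l => k f /= h.
  have -> : k + L < a = true by lia.
  by rewrite andbT.
rewrite wE !shift_cat /= !cats0 shift_cat /= !cats0.
set u' := shift_word q M L false u _; set x' := shift_letter _ _ _ _ _ _.
set v' := shift_word q M L false v _; set y' := shift_letter _ _ _ _ _ z.
set z' := shift_word _ _ _ _ z _.
have uE : u' = shift_word q M L false u (v ++ z).
  apply: eq_shift => l b /lu h; rewrite cnt_cons !cnt_cat cnt_cons /=.
  case: l h => k f /= h; have -> : (a + L < k) = false by lia.
  by rewrite !andbF.
have vE : v' = shift_word q M L false v z.
  apply: eq_shift => l b /lv h; rewrite cnt_cons /=.
  case: l h => k f /= h; have -> : (a + L < k) = false by lia.
  by rewrite !andbF.
have {IH} IH : fp_equiv q.+1 (u' ++ v' ++ z') [::].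
  by move: IH; rewrite !shift_cat !cats0 -uE -vE.
apply: fp_trans IH; apply: fp_cat; first exact: fp_refl.
have hs : q * size v + q <= M by lia.
have ht : q * size (v ++ (a, ~~ e) :: z) <= M.
  apply: leq_trans (leq_trans (leq_addr q _) hM).
  by rewrite leq_mul2l wE [size (u ++ _)]size_cat (leq_trans (leqnSn _) (leq_addl _ _)) orbT.
have /andP[ax _] := shift_letter_bound L false (a, e) ht.
have far : all (fun l => l.1 + M < x'.1) v'.
  apply/allP => l' /mem_shift[v1 [l [v2 [v12 ->]]]].
  have hl : q * size (v2 ++ (a, ~~ e) :: z) <= M.
    apply: leq_trans ht; rewrite leq_mul2l v12 -catA [size (v1 ++ _)]size_cat /=.
    by rewrite (leq_trans (leqnSn _) (leq_addl _ _)) orbT.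
  have /andP[_ hl'] := shift_letter_bound L false l hl.
  have := lv l; rewrite v12 mem_cat mem_head orbT => /(_ isT) la.
  rewrite -/x' /= in ax; move: ax hl' la; move: (shift_letter _ _ _ _ l _) => l0.
  by case: l {hl v12} => k f; case: l0 => k0 f0 /=; lia.
(* With [s = false] the shift of the first letter subtracts the drift caused by [v]. Pushing it
   through [v'] restores that drift and leaves only the contribution of [z], which is the shift of
   its partner. *)
have push : fp_equiv q.+1 (x' :: v') (v' ++ [:: inv_letter y']).
  have sv : q * size v' + q <= M by rewrite size_shift.
  have xE : x' = (x'.1, e) by [].
  have := fp_push e far sv; rewrite -xE; congr (fp_equiv _ _ (_ ++ [:: _])).
  rewrite /inv_letter [y'.2]/= negbK; congr pair.
  have cq b : q * cnt L b a z <= q * size z by exact: cnt_budget.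
  have sq b : q * sgn b v <= q * size v by rewrite leq_mul2l count_size orbT.
  have := cq true; have := cq false; have := sq true; have := sq false.
  rewrite !sgn_shift /= !cnt_cat !cnt_cons /= !cv !mulnDr.
  have -> : (a + L < a) = false by lia.
  by rewrite !andbF !muln0; lia.
have := fp_cat push (fp_refl _ (y' :: z')); rewrite /= -catA.
move=> h; apply: fp_trans h _; apply: fp_cat; first exact: fp_refl.
exact: (fp_ctx [::] z' (fp_cancel_inv' _ y')).
Qed.

(** * Counting ideal words *)

Definition ideal_tuples (T : finType) (d : nat) : {set d.-tuple (T * bool)} :=
  [set t : d.-tuple (T * bool) | uniq t & [forall x, (x \in t) ==> ((x.1, ~~ x.2) \in t)]].

(** An ideal tuple is an ordering of its support times the two signs; fibring over supports of size
    [d./2] gives fibres of size the factorial of [d]. *)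
Lemma card_ideal_tuples (T : finType) d :
  #|ideal_tuples T d| = if odd d then 0 else 'C(#|T|, d./2) * d`!.
Proof.
pose supp (t : d.-tuple (T * bool)) := [set i | (i, true) \in t].
have mem_supp t x : t \in ideal_tuples T d -> (x \in t) = (x.1 \in supp t).
  rewrite inE => /andP[_ /forallP inv]; rewrite inE; case: x => i [] //.
  by apply/idP/idP => h; have := implyP (inv _) h.
have card_supp t : t \in ideal_tuples T d -> #|supp t| * 2 = d.
  move=> tI; have /andP[ut _] : uniq t && true by move: tI; rewrite inE => /andP[->].
  rewrite -card_bool -cardsT -cardsX -[RHS](size_tuple t) -(card_uniqP ut).
  by apply: eq_card => x; rewrite mem_supp // !inE andbT.
case: ifP => [od|ev].
  apply: eq_card0 => t; apply/negP => /card_supp td.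
  by move: od; rewrite -td muln2 odd_double.
have dE : d./2 * 2 = d by rewrite muln2 halfK ev subn0.
rewrite -sum1_card (partition_big supp (fun S : {set T} => #|S| == d./2)) /=; last first.
  by move=> t /card_supp h; rewrite -(eqn_pmul2r (isT : 0 < 2)) h dE.
rewrite (eq_bigr (fun=> d`!)) => [|S /eqP cS].
  rewrite sum_nat_const; congr (_ * _).
  by rewrite -card_draws; apply: eq_card => S; rewrite !inE.
have cX : #|finset.setX S [set: bool]| = d by rewrite cardsX cS cardsT card_bool.
transitivity #|[set t : d.-tuple (T * bool) | all (mem (finset.setX S [set: bool])) t & uniq t]|.
  rewrite -sum1_card; apply: eq_bigl => t; rewrite [in RHS]inE.
  apply/andP/andP => [[tI /eqP <-]|[/allP sub ut]].
    split; last by move: tI; rewrite inE => /andP[].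
    by apply/allP => x; rewrite mem_supp //= !inE andbT.
  have eqt : t =i finset.setX S [set: bool].
    by apply/subset_cardP; [rewrite cX (card_uniqP ut) size_tuple | apply/fintype.subsetP].
  split; last by apply/eqP/finset.setP => i; rewrite inE eqt !inE andbT.
  rewrite inE ut; apply/forallP => x; apply/implyP.
  by rewrite !eqt !inE.
by rewrite card_uniq_tuples cX ffactnn.
Qed.

Lemma count_ideal n d :
  count ideal (words (alph n.+1) d) = if odd d then 0 else 'C(n.+1, d./2) * d`!.
Proof.
rewrite -[in RHS](card_ord n.+1) -card_ideal_tuples.
pose f (x : 'I_n.+1 * bool) : letter := (val x.1, x.2).
have f_inj : injective f by move=> [i e] [j e'] [/ord_inj -> ->].
rewrite cardE -(size_map (fun t : d.-tuple _ => map f t)) -size_filter.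
apply/perm_size/uniq_perm.
- by rewrite filter_uniq // words_uniq // alph_uniq.
- by rewrite map_inj_uniq ?enum_uniq // => t t' /(inj_map f_inj)/val_inj.
have idf (t : seq ('I_n.+1 * bool)) :
    ideal (map f t) = uniq t && [forall x, (x \in t) ==> ((x.1, ~~ x.2) \in t)].
  rewrite /ideal map_inj_uniq //; congr andb; rewrite all_map.
  apply/allP/forallP => h x.
    by apply/implyP => /h /=; rewrite (mem_map f_inj t (x.1, ~~ x.2)).
  by move=> xt; rewrite /= (mem_map f_inj t (x.1, ~~ x.2)); exact: implyP (h x) xt.
move=> w; rewrite mem_filter mem_words_alph; apply/and3P/mapP.
  case=> iw /eqP wd /allP wn.
  pose t := [seq (inord x.1 : 'I_n.+1, x.2) | x <- w].
  have td : size t == d by rewrite size_map wd.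
  have tw : map f t = w.
    rewrite -map_comp -[RHS]map_id; apply/eq_in_map => x /wn xn.
    by rewrite /f /= inordK //; case: (x).
  by exists (Tuple td) => //; rewrite mem_enum inE -idf tw.
case=> t; rewrite mem_enum inE -idf => it ->; split => //.
  by rewrite size_map size_tuple.
by rewrite all_map; apply/allP => x _ /=.
Qed.

(** * Bounds on the number of trivial words *)

Lemma count_inj_leq (T U : eqType) (f : T -> U) (P : pred T) (Q : pred U) s t :
  uniq s -> (forall x, x \in s -> P x -> f x \in t /\ Q (f x)) ->
  (forall x y, x \in s -> y \in s -> P x -> P y -> f x = f y -> x = y) ->
  count P s <= count Q t.
Proof.
move=> us sub inj; rewrite -!size_filter -(size_map f); apply: uniq_leq_size.
  rewrite map_inj_in_uniq ?filter_uniq // => x y.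
  rewrite !mem_filter => /andP[Px xs] /andP[Py ys]; exact: inj.
by move=> _ /mapP[x + ->]; rewrite !mem_filter => /andP[Px xs]; have [-> ->] := sub x xs Px.
Qed.

Lemma shift_words q M L s n d w :
  q * d <= M -> w \in words (alph n) d ->
  shift_word q M L s w [::] \in words (alph (n + 2 * M)) d.
Proof.
move=> qd; rewrite !mem_words_alph size_shift => /andP[/eqP wd /allP wn].
rewrite wd eqxx; apply/allP => y /mem_shift[u [x [v [wE ->]]]].
have hv : q * size (v ++ [::]) <= M.
  apply: leq_trans qd; rewrite leq_mul2l -wd wE cats0 [size (u ++ _)]size_cat /=.
  by rewrite (leq_trans (leqnSn _) (leq_addl _ _)) orbT.
have /andP[_ xb] := shift_letter_bound L s x hv.
by apply: leq_ltn_trans xb _; rewrite ltn_add2r wn // wE mem_cat mem_head orbT.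
Qed.

(** The margin that [trivial_close] and [trivial_pair] demand for words of length [d]. *)
Definition max_shift (q d : nat) : nat := q * d + q.+1.

Definition cover_const (q d : nat) : nat :=
  (d.-1./2 * size (alph (4 * (5 * max_shift q d) + 1))) ^ d.

(** Unpaired words go into the error term; on paired ones the shift with [s = true] is injective
    into ideal words over a slightly larger alphabet. *)
Lemma count_trivial_le q n d :
  0 < q -> 0 < n ->
  count (fp_trivial q.+1) (words (alph n) d) <=
    count ideal (words (alph (n + 2 * max_shift q d)) d)
    + n ^ d.-1./2 * cover_const q d.
Proof.
(* With [L = 3 * M] and this [K], the constraints [3 * M <= L] and [L + 2 * M <= K] of [shift_inj]
   are equalities. *)
rewrite /cover_const; set M := max_shift q d; set K := 5 * M => q0 n0.
have hK : 2 * M + 2 <= K by rewrite /K /M /max_shift; lia.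
have ML : M <= 3 * M by lia.
have LK : 3 * M <= K by lia.
apply: leq_trans (@count_paired n d K (fp_trivial q.+1) n0 _) _.
  move=> w /asboolP triv wd x xw; apply: (trivial_close triv q0 _ hK xw).
  by rewrite wd.
rewrite leq_add2r; apply: (@count_inj_leq _ _ (fun w => shift_word q M (3 * M) true w [::])).
- by rewrite words_uniq // alph_uniq.
- move=> w wn /andP[/asboolP triv pw].
  have wd : size w = d by move: wn; rewrite mem_words_alph => /andP[/eqP].
  split; first by apply: shift_words => //; exact: leq_addr.
  by apply: (trivial_shift_ideal triv q0 _ hK ML LK pw); rewrite wd.
- move=> v w vn _ /andP[/asboolP triv pv] _.
  have vd : size v = d by move: vn; rewrite mem_words_alph => /andP[/eqP].
  apply: (@shift_inj _ _ _ K) => //; first by rewrite vd; exact: leq_addr.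
    by lia.
  by apply: (trivial_paired_sep triv q0 _ hK pv); rewrite vd.
Qed.

(** The shift with [s = false] injects paired ideal words into trivial ones. Two separate injections
    suffice, without being mutually inverse. *)
Lemma count_trivial_ge q n d :
  0 < n ->
  count ideal (words (alph n) d) <=
    count (fp_trivial q.+1) (words (alph (n + 2 * max_shift q d)) d)
    + n ^ d.-1./2 * cover_const q d.
Proof.
rewrite /cover_const; set M := max_shift q d; set K := 5 * M => n0.
have LK : 3 * M <= K by lia.
apply: leq_trans (@count_paired n d K ideal n0 _) _.
  by move=> w iw wd x xw; exact: ideal_count_close.
rewrite leq_add2r; apply: (@count_inj_leq _ _ (fun w => shift_word q M (3 * M) false w [::])).
- by rewrite words_uniq // alph_uniq.
- move=> w wn /andP[iw pw].
  have wd : size w = d by move: wn; rewrite mem_words_alph => /andP[/eqP].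
  split; first by apply: shift_words => //; exact: leq_addr.
  apply/asboolP; apply: (ideal_shift_trivial iw _ _ LK LK).
    by move=> x y xw yw; exact: ideal_paired_sep iw pw xw yw.
  by rewrite wd leq_add2l.
- move=> v w vn _ /andP[iv pv] _.
  have vd : size v = d by move: vn; rewrite mem_words_alph => /andP[/eqP].
  apply: (@shift_inj _ _ _ K) => //; first by rewrite vd; exact: leq_addr.
    by lia.
  move=> x y xv yv; case/orP: (ideal_paired_sep iv pv xv yv) => [/eqP -> | ->].
    by rewrite close_refl.
  by rewrite orbT.
Qed.

(** At [d = 0] the truncated predecessor gives [dfact 0 = 1], the correct zeroth moment. *)
Definition gauss_moment (d : nat) : nat := if odd d then 0 else dfact d.-1.

(** The odd factors form the double factorial; halving the even ones leaves the factorial of [k]. *)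
Lemma fact_dfact k : (2 * k)`! = dfact (2 * k).-1 * 2 ^ k * k`!.
Proof.
elim: k => // k IH; rewrite mulnS !addSn add0n !factS IH /= expnS.
case: k {IH} => // k; rewrite mulnS /= ; nia.
Qed.

Lemma count_idealE n d :
  count ideal (words (alph n.+1) d) = gauss_moment d * 2 ^ d./2 * n.+1 ^_ d./2.
Proof.
rewrite count_ideal /gauss_moment; case: ifP => [_|ev]; first by rewrite mul0n.
have dE : d = 2 * d./2 by rewrite mul2n halfK ev subn0.
rewrite {2}dE fact_dfact -dE -bin_ffact; lia.
Qed.

Lemma leq_exp_base m n k : m <= n -> m ^ k <= n ^ k.
Proof. by case: k => // k mn; rewrite leq_exp2r. Qed.

Lemma ffact_leq_exp n k : n ^_ k <= n ^ k.
Proof.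
have -> : n ^ k = \prod_(i < k) n by rewrite prod_nat_const card_ord.
rewrite ffact_prod.
by apply: leq_prod => i _; exact: leq_subr.
Qed.

Lemma exp_leq_ffact n k : (n - k) ^ k <= n ^_ k.
Proof.
have -> : (n - k) ^ k = \prod_(i < k) (n - k) by rewrite prod_nat_const card_ord.
rewrite ffact_prod.
by apply: leq_prod => i _; rewrite leq_sub2l // ltnW.
Qed.

(** * The limit *)

Local Open Scope classical_set_scope.
Local Open Scope ring_scope.

(** Both bounds on the moment are polynomials in [y], the inverse square root of the number of
    generators: [e] records a bounded change of that number, [c] the unpaired words. Continuity at
    [0] yields the limit [b]. *)
Definition moment_poly (R : realType) (b e c : R) (k : nat) : {poly R} :=
  b%:P * (1 + e%:P * 'X^2) ^+ k + c%:P * 'X.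

Lemma horner_moment_poly (R : realType) (b e c : R) k y :
  (moment_poly b e c k).[y] = b * (1 + e * y ^+ 2) ^+ k + c * y.
Proof. by rewrite /moment_poly !hornerE. Qed.

Lemma cvg_moment_poly (R : realType) (b e c : R) k :
  (fun n => (moment_poly b e c k).[(Num.sqrt n.+1%:R)^-1]) @ \oo --> b.
Proof.
have y0 : (fun n => (Num.sqrt n.+1%:R)^-1 : R) @ \oo --> (0 : R).
  rewrite (_ : (fun n => _) = (@Num.sqrt R) \o harmonic); last first.
    by apply/funext => n /=; rewrite sqrtrV.
  rewrite -[X in _ --> X]sqrtr0.
  exact: (@continuous_cvg nat R R _ _ (@harmonic R) _ 0 (@sqrt_continuous R 0) cvg_harmonic).
have b0 : (moment_poly b e c k).[0] = b.
  by rewrite horner_moment_poly expr0n /= !mulr0 !addr0 expr1n mulr1.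
rewrite -[X in _ --> X]b0.
exact: (@continuous_cvg nat R R _ _ _ (horner (moment_poly b e c k)) 0
  (@continuous_horner R _ 0) y0).
Qed.

(** Each factor [m] is absorbed by [y ^+ 2]; one or two factors [y] remain, according to the parity
    of [d]. *)
Lemma error_term (R : realType) (n d m : nat) (y : R) : (0 < d)%N ->
  0 <= y <= 1 -> n%:R * y ^+ 2 = 1 -> (m <= n)%N ->
  y ^+ d * (m ^ d.-1./2)%:R <= y.
Proof.
move=> d0 /andP[y0 y1] ny mn.
have dE : d = ((d - d.-1./2 * 2) + 2 * d.-1./2)%N by lia.
rewrite {1}dE exprD natrX exprM -mulrA -exprMn.
have le1 : (y ^+ 2 * m%:R) ^+ d.-1./2 <= 1.
  apply: exprn_ile1; first by rewrite mulr_ge0 ?exprn_ge0 ?ler0n.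
  by rewrite -[leRHS]ny mulrC ler_wpM2r ?exprn_ge0 // ler_nat.
apply: (@le_trans _ _ (y ^+ (d - d.-1./2 * 2))).
  by rewrite ler_piMr ?exprn_ge0.
by rewrite -[leRHS]expr1 ler_wiXn2l //; lia.
Qed.

Lemma main_term (R : realType) (n d k : nat) (e y s : R) : ~~ odd d -> k = d./2 ->
  n%:R * y ^+ 2 = 1 -> 2 * s ^+ 2 = 1 ->
  (y * s) ^+ d * (2 ^+ k * (n%:R + e) ^+ k) = (1 + e * y ^+ 2) ^+ k.
Proof.
move=> ev kE ny s2; have -> : d = (2 * k)%N by lia.
rewrite exprM -!exprMn; congr (_ ^+ _).
rewrite exprMn.
have -> : y ^+ 2 * s ^+ 2 * (2 * (n%:R + e)) = (2 * s ^+ 2) * (n%:R * y ^+ 2 + e * y ^+ 2) by ring.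
by rewrite ny s2 mul1r.
Qed.

Theorem theorem1 (R : realType) (p : nat) (hp : (2 <= p)%N) (d : nat) :
  (fun n : nat => gamma p (ga_pow (s_el R n.+1) d)) @ \oo -->
    (if odd d then 0 else (dfact d.-1)%:R : R).
Proof.
have -> : (if odd d then 0 else (dfact d.-1)%:R) = (gauss_moment d)%:R :> R.
  by rewrite /gauss_moment; case: ifP.
(* For [d = 0] the empty word is the only one; [error_term] requires [0 < d]. *)
case: d => [|d'].
  rewrite (_ : (fun n => _) = cst 1); first exact: cvg_cst.
  apply/funext => n; rewrite gamma_s_el expr0 mul1r /= /fp_trivial asboolT //.
  exact: fp_refl.
have d0 : (0 < d'.+1)%N by [].
move: d'.+1 d0 => d d0.
case: p hp => // q; rewrite ltnS => q0.
pose M := max_shift q d.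
pose C := cover_const q d.
(* The term [2 * M] pays for the alphabet growth under shifting, [d./2] for replacing a falling
   factorial by a power in the lower bound. *)
pose E := (2 * M + d./2)%N.
pose b : R := (gauss_moment d)%:R.
apply: (@squeeze_cvgr _ _ _ _
  (fun n => (moment_poly b (- E%:R) (- C%:R) d./2).[(Num.sqrt n.+1%:R)^-1])
  (fun n => (moment_poly b E%:R C%:R d./2).[(Num.sqrt n.+1%:R)^-1]));
  [|exact: cvg_moment_poly|exact: cvg_moment_poly].
near=> n.
rewrite gamma_s_el !horner_moment_poly.
set y := (Num.sqrt n.+1%:R)^-1; set s := (Num.sqrt 2)^-1.
have y01 : 0 <= y <= 1.
  rewrite invr_ge0 sqrtr_ge0 /= invf_le1 ?sqrtr_gt0 ?ltr0n //.
  by rewrite -{1}sqrtr1 ler_wsqrtr // ler1n.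
have s01 : 0 <= s <= 1.
  rewrite invr_ge0 sqrtr_ge0 /= invf_le1 ?sqrtr_gt0 ?ltr0n //.
  by rewrite -{1}sqrtr1 ler_wsqrtr // ler1n.
have ny : n.+1%:R * y ^+ 2 = 1 by rewrite exprVn sqr_sqrtr ?ler0n // mulfV ?pnatr_eq0.
have s2 : 2 * s ^+ 2 = 1 by rewrite exprVn sqr_sqrtr ?ler0n // mulfV ?pnatr_eq0.
have ys0 : 0 <= (y * s) ^+ d by case/andP: y01 => ? _; case/andP: s01 => ? _; rewrite exprn_ge0 ?mulr_ge0.
have err m : (m <= n.+1)%N -> (y * s) ^+ d * (m ^ d.-1./2 * C)%:R <= C%:R * y.
  move=> mn; rewrite natrM mulrA mulrC ler_wpM2l ?ler0n //.
  apply: le_trans (error_term d0 y01 ny mn).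
  rewrite ler_wpM2r ?ler0n // exprMn ler_piMr //.
    by case/andP: y01 => ? _; rewrite exprn_ge0.
  by case/andP: s01 => ? ?; rewrite exprn_ile1.
have main e (X : R) : X = n.+1%:R + e ->
    (y * s) ^+ d * (b * 2 ^+ d./2 * X ^+ d./2) = b * (1 + e * y ^+ 2) ^+ d./2.
  move=> ->; rewrite -mulrA mulrCA /b /gauss_moment.
  by case: ifP => od; rewrite ?mul0r // main_term ?od.
have nE : (E < n)%N by near: n; exact: nbhs_infty_gt.
set N := count _ _.
apply/andP; split.
  have ge : (gauss_moment d * 2 ^ d./2 * (n.+1 - E) ^ d./2 <= N + n.+1 ^ d.-1./2 * C)%N.
    (* Starting from [n.+1 - 2 * M] generators, the enlarged alphabet has exactly [n.+1]. *)
    have := @count_trivial_ge q (n.+1 - 2 * M) d; rewrite -/M -/C subnK; last by lia.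
    have -> : (n.+1 - 2 * M = (n - 2 * M).+1)%N by lia.
    rewrite count_idealE => /(_ isT) h.
    apply: leq_trans (leq_trans _ h) _.
      rewrite leq_mul2l; apply/orP; right; apply: leq_trans (exp_leq_ffact _ _).
      have -> : (n.+1 - E = (n - 2 * M).+1 - d./2)%N by lia.
      exact: leqnn.
    rewrite leq_add2l leq_mul2r; apply/orP; right.
    by apply: leq_exp_base; lia.
  rewrite [- C%:R * y]mulNr lerBlDr -(main _ (n.+1 - E)%:R); last by rewrite natrB //; lia.
  apply: (@le_trans _ _ ((y * s) ^+ d * (N + n.+1 ^ d.-1./2 * C)%:R)).
    by rewrite ler_wpM2l // /b -!natrX -!natrM ler_nat.
  by rewrite natrD mulrDr lerD2l err.
have le : (N <= gauss_moment d * 2 ^ d./2 * (n.+1 + E) ^ d./2 + n.+1 ^ d.-1./2 * C)%N.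
  apply: leq_trans (@count_trivial_le q n.+1 d q0 isT) _; rewrite -/M -/C leq_add2r.
  rewrite addSn count_idealE leq_mul2l; apply/orP; right.
  apply: leq_trans (ffact_leq_exp _ _) _.
  by apply: leq_exp_base; rewrite /E; lia.
rewrite -(main _ (n.+1 + E)%:R); last by rewrite natrD.
apply: (@le_trans _ _ ((y * s) ^+ d *
   (gauss_moment d * 2 ^ d./2 * (n.+1 + E) ^ d./2 + n.+1 ^ d.-1./2 * C)%:R)).
  by rewrite ler_wpM2l // ler_nat.
rewrite natrD mulrDr; apply: lerD; last exact: err.
by rewrite /b -!natrX -!natrM.
Unshelve. all: end_near.
Qed.
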